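(* (a) $T(1)=T(F)=T(F^2)=0$ and $T(F^3)=F$. (b) $T$ maps $\mathbb{Z}/2[F]$ into itself; in fact, for every $n\ge 0$, $T(F^n)$ is a sum of $F^k$ with $k\le n-2$ and $k\equiv n\pmod 2$.
   Context: $\mathbb{Z}/2[r]$ is the polynomial ring over the field with two elements. Let $F=r(r+1)^3$ and $G=r^3(r+1)$. $\mathbb{Z}/2[r]$ is a free $\mathbb{Z}/2[G]$-module with basis $1,r,r^2,r^3$. Let $U:\mathbb{Z}/2[r]\to\mathbb{Z}/2[r]$ be the map $U\big(\sum_{i=0}^3 g_i(G)r^i\big)=\sum_{i=0}^3 g_i(F)\,U(r^i)$ (for polynomials $g_i$ over $\mathbb{Z}/2$), where $U(1)=1$, $U(r)=r$, $U(r^2)=r^2$, $U(r^3)=r^3+r^2+r$. Let $\alpha:\mathbb{Z}/2[F]\to\mathbb{Z}/2[G]$ be the ring isomorphism with $\alpha(F^n)=G^n$. For $f\in\mathbb{Z}/2[F]$, $T(f)=U(f)+\alpha(f)$. *)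

(* Defs.v *)
From mathcomp Require Import all_boot all_order all_algebra.

Set Implicit Arguments.
Unset Strict Implicit.
Unset Printing Implicit Defensive.

Import GRing.Theory.
Local Open Scope ring_scope.

(* Coordinates in the basis 1, X, ..., X^(d-1) of K[X] over K[P], where P is
   monic of degree d > 0.  The k-th digit of f in base P is (f %/ P^k) %% P,
   and the i-th coordinate collects the coefficients of X^i in all the digits:
   f = \sum_(i < d) (coord P i f)(P) X^i (lemmas coordP and coordK). *)
Definition coord (K : fieldType) (P : {poly K}) (i : nat) (f : {poly K}) :
    {poly K} :=
  \poly_(k < size f) ((f %/ P ^+ k) %% P)`_i.

Section CoordTheory.
Variables (K : fieldType) (P : {poly K}).
Hypotheses (Pmon : P \is monic) (Pgt1 : (1 < size P)%N).

Let P_neq0 : P != 0. Proof. exact: monic_neq0. Qed.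

Lemma coordE i k f : (coord P i f)`_k = ((f %/ P ^+ k) %% P)`_i.
Proof.
rewrite coef_poly; case: ltnP => // le_fk.
rewrite divp_small ?mod0p ?coef0 //; apply: (leq_ltn_trans le_fk).
rewrite -[ltnRHS]prednK ?size_poly_gt0 ?expf_neq0 // size_exp ltnS.
by rewrite leq_pmull // -ltnS prednK // ltnW.
Qed.

Lemma coord_mulD i q (c : {poly K}) : (size c < size P)%N ->
  coord P i (q * P + c) = coord P i q * 'X + (c`_i)%:P.
Proof.
move=> ltcP; apply/polyP=> k; rewrite coordE coefD coefMX coefC.
case: k => [|k] /=.
  by rewrite expr0 divp1 modpD modp_mull add0r modp_small // add0r.
rewrite addr0 coordE exprS -divp_divl divpD mulpK // (divp_small ltcP).
by rewrite addr0.
Qed.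

Lemma coord0 i : coord P i 0 = 0.
Proof. by apply/polyP=> k; rewrite coordE div0p mod0p !coef0. Qed.

Lemma coordP f :
  f = \sum_(i < (size P).-1) (coord P i f \Po P) * 'X^i.
Proof.
have [m] := ubnP (size f); elim: m f => // m IHm f; rewrite ltnS => le_fm.
have [-> | f_neq0] := eqVneq f 0.
  by rewrite big1 // => i _; rewrite coord0 comp_poly0 mul0r.
have lt_c : (size (f %% P)%R < size P)%N by rewrite ltn_modp.
rewrite {2}(divp_eq f P).
under eq_bigr => i _.
  rewrite coord_mulD // comp_polyD comp_polyM comp_polyX comp_polyC.
  rewrite mulrDl mulrAC mul_polyC.
  over.
rewrite big_split /= -big_distrl /= -IHm; last first.
  apply: leq_trans le_fm; rewrite size_divp // ltn_subrL.
  by rewrite -subn1 subn_gt0 Pgt1 size_poly_gt0 f_neq0.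
rewrite {1}(divp_eq f P); congr (_ + _).
rewrite -poly_def; apply/polyP => i; rewrite coef_poly; case: ltnP => // le_i.
by rewrite nth_default // -ltnS (leq_trans lt_c) // -(ltn_predK Pgt1) ltnS.
Qed.

Lemma coordK (g : nat -> {poly K}) (i : nat) : (i < (size P).-1)%N ->
  coord P i (\sum_(j < (size P).-1) (g j \Po P) * 'X^j) = g i.
Proof.
move=> lt_i.
have [m] := ubnP (\max_(j < (size P).-1) size (g j)).
elim: m g => // m IHm g; rewrite ltnS => le_m.
have [m0 | m_gt0] := posnP m.
  have g0 j : (j < (size P).-1)%N -> g j = 0.
    move=> lt_j; apply/eqP; rewrite -size_poly_leq0.
    rewrite m0 in le_m; apply: leq_trans le_m.
    exact: (leq_bigmax (Ordinal lt_j)).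
  rewrite big1 ?coord0 ?g0 // => j _.
  by rewrite g0 // comp_poly0 mul0r.
pose h j := g j %/ 'X; pose c j := (g j)`_0.
have gE j : g j = h j * 'X + (c j)%:P.
  rewrite {1}(divp_eq (g j) 'X); congr (_ + _).
  by rewrite -[X in _ %% X]subr0 -polyC0 modp_XsubC horner_coef0.
under eq_bigr => j _.
  rewrite gE comp_polyD comp_polyM comp_polyX comp_polyC.
  rewrite mulrDl mulrAC mul_polyC.
  over.
rewrite big_split /= -big_distrl /= -poly_def coord_mulD; last first.
  by rewrite -[ltnRHS](ltn_predK Pgt1) ltnS size_poly.
rewrite IHm ?coef_poly ?lt_i -?gE //.
apply: leq_ltn_trans (_ : m.-1 < m)%N; last by rewrite prednK.
apply/bigmax_leqP => j _; rewrite /h size_divp ?polyX_eq0 // size_polyX.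
rewrite -[leqRHS]subn1; apply: leq_sub2r; apply: leq_trans le_m.
exact: (leq_bigmax j).
Qed.

End CoordTheory.

Definition polF : {poly 'F_2} := 'X * ('X + 1) ^+ 3.
Definition polG : {poly 'F_2} := 'X ^+ 3 * ('X + 1).

(* The values U(1), U(r), U(r^2), U(r^3). *)
Definition Ubase (i : 'I_4) : {poly 'F_2} :=
  tnth [tuple 1; 'X; 'X^2; 'X^3 + 'X^2 + 'X] i.

Definition U (f : {poly 'F_2}) : {poly 'F_2} :=
  \sum_(i < 4) (coord polG i f \Po polF) * Ubase i.

Definition in_Z2F (f : {poly 'F_2}) : Prop := exists h, f = h \Po polF.

(* On Z/2[F] this is h(F) |-> h(G) (lemma alpha_comp): the polynomial h is the
   coordinate at 1 of h(F).  Values outside Z/2[F] are irrelevant. *)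
Definition alpha (f : {poly 'F_2}) : {poly 'F_2} := coord polF 0 f \Po polG.

(* Meaningful for f in Z/2[F] only. *)
Definition T (f : {poly 'F_2}) : {poly 'F_2} := U f + alpha f.

Lemma monic_XD1 : ('X + 1 : {poly 'F_2}) \is monic.
Proof. by rewrite -[1]opprK -polyCN monicXsubC. Qed.

Lemma size_XD1 : size ('X + 1 : {poly 'F_2}) = 2.
Proof. by rewrite -[1]opprK -polyCN size_XsubC. Qed.

Lemma size_exp_XD1 n : size (('X + 1 : {poly 'F_2}) ^+ n) = n.+1.
Proof. by rewrite -[1]opprK -polyCN size_exp_XsubC. Qed.

Lemma polF_monic : polF \is monic.
Proof. by rewrite monicMl ?monicX // monic_exp // monic_XD1. Qed.

Lemma polG_monic : polG \is monic.
Proof. by rewrite monicMl ?monic_XD1 // monic_exp // monicX. Qed.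

Lemma size_polF : size polF = 5.
Proof.
rewrite size_monicM ?monicX ?monic_neq0 ?monic_exp ?monic_XD1 //.
by rewrite size_polyX size_exp_XD1.
Qed.

Lemma size_polG : size polG = 5.
Proof.
rewrite size_monicM ?monic_exp ?monicX ?monic_neq0 ?monic_XD1 //.
by rewrite size_XD1 size_polyXn.
Qed.

Lemma UE (g : nat -> {poly 'F_2}) :
  U (\sum_(i < 4) (g i \Po polG) * 'X^i)
    = \sum_(i < 4) (g i \Po polF) * Ubase i.
Proof.
apply: eq_bigr => i _; congr ((_ \Po _) * _).
have := @coordK _ polG polG_monic _ g i.
by rewrite size_polG /=; apply.
Qed.

Lemma U_Xn (i : 'I_4) : U 'X^i = Ubase i.
Proof.
have := UE (fun j => (j == i)%:R).
rewrite (bigD1 i) // big1 => [|j /negPf ne_ji]; last first.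
  by rewrite val_eqE ne_ji comp_poly0 mul0r.
rewrite (bigD1 i) // big1 => [|j /negPf ne_ji]; last first.
  by rewrite val_eqE ne_ji comp_poly0 mul0r.
by rewrite /= eqxx !rmorph1 !mul1r !addr0.
Qed.

Lemma alpha_comp h : alpha (h \Po polF) = h \Po polG.
Proof.
have := @coordK _ polF polF_monic _ (fun j => if j == 0%N then h else 0) 0.
rewrite size_polF /= big_ord_recl big1 => [|j _]; last first.
  by rewrite /= comp_poly0 mul0r.
by rewrite /= expr0 mulr1 addr0 /alpha => ->.
Qed.

Lemma alpha_Fn n : alpha (polF ^+ n) = polG ^+ n.
Proof. by rewrite -(comp_Xn_poly polF) alpha_comp comp_Xn_poly. Qed.

(* Main.v *)
Require Import Defs.
From mathcomp Require Import all_boot all_order all_algebra.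
From mathcomp Require Import ring.

Import GRing.Theory.
Local Open Scope ring_scope.

(** [F^4 + G^4 + F G = 0] is symmetric in [F] and [G]. As [U] exchanges [G] for
    [F] in scalars while [alpha] sends [F^n] to [G^n], both [U(F^n)] and [G^n]
    satisfy [u_(n+4) = F^4 u_n + F u_(n+1)], hence so does [T(F^n)], which is
    thus determined by [0, 0, 0, F]. *)

(** [ring] does not know that 2 = 0 here. Supplying half of the difference as [d] turns a
    characteristic 2 identity into one valid in every commutative ring. *)
Lemma poly_F2_eq (d a b : {poly 'F_2}) : a = b + 2 * d -> a = b.
Proof.
by move=> ->; rewrite -polyC_natr (_ : 2%:R = 0 :> 'F_2) ?mul0r ?addr0 //;
  apply/val_inj.
Qed.

Lemma polFE : polF = polG + 'X + 'X^2.
Proof.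
apply: (poly_F2_eq (('X + 'X^2) ^+ 2 - polG)); rewrite /polF /polG; ring.
Qed.

(** With [s = r + r^2], one has [F = G + s] and [F G = s^4], so this is additivity of the fourth
    power in characteristic 2. *)
Lemma polFG_rel : polF ^+ 4 = polG ^+ 4 + polG * polF.
Proof.
have -> : polG * polF = ('X + 'X^2) ^+ 4 by rewrite /polF /polG; ring.
rewrite polFE; set s := 'X + 'X^2; rewrite -addrA -/s.
(* Half of the middle terms of the binomial expansion of [(G + s)^4]. *)
apply: (poly_F2_eq
  (2 * s ^+ 3 * polG + 3 * s ^+ 2 * polG ^+ 2 + 2 * s * polG ^+ 3)); ring.
Qed.

Lemma polGF_rel : polG ^+ 4 = polF ^+ 4 + polF * polG.
Proof. rewrite polFG_rel; apply: (poly_F2_eq (- (polF * polG))); ring. Qed.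

Lemma U_expand f :
  f = \sum_(i < 4) (Defs.coord polG i f \Po polG) * 'X^i.
Proof.
by have := @coordP _ _ polG_monic _ f; rewrite size_polG; apply.
Qed.

Lemma U_add f g : U (f + g) = U f + U g.
Proof.
rewrite {1}(U_expand f) {1}(U_expand g) -big_split /=.
under eq_bigr => i _ do rewrite -mulrDl -comp_polyD.
rewrite (UE (fun i => Defs.coord polG i f + Defs.coord polG i g)) /U -big_split /=.
by apply: eq_bigr => i _; rewrite comp_polyD mulrDl.
Qed.

(** Multiplying by [h(G)] multiplies every coordinate by [h], which makes [U] semilinear. *)
Lemma U_mulG h f : U ((h \Po polG) * f) = (h \Po polF) * U f.
Proof.
rewrite {1}(U_expand f) big_distrr /=.
under eq_bigr => i _ do rewrite mulrA -comp_polyM.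
rewrite (UE (fun i => h * Defs.coord polG i f)) /U big_distrr /=.
by apply: eq_bigr => i _; rewrite comp_polyM mulrA.
Qed.

Lemma U_basis (g0 g1 g2 g3 : {poly 'F_2}) :
  U ((g0 \Po polG) + (g1 \Po polG) * 'X + (g2 \Po polG) * 'X^2
     + (g3 \Po polG) * 'X^3)
  = (g0 \Po polF) + (g1 \Po polF) * 'X + (g2 \Po polF) * 'X^2
    + (g3 \Po polF) * ('X^3 + 'X^2 + 'X).
Proof.
have := UE (nth 0 [:: g0; g1; g2; g3]).
by rewrite !big_ord_recl !big_ord0 /= !addr0 expr0 !mulr1 !addrA.
Qed.

Lemma T_expF n : T (polF ^+ n) = U (polF ^+ n) + polG ^+ n.
Proof. by rewrite /T alpha_Fn. Qed.

Lemma T_expF_rec n :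
  T (polF ^+ n.+4)
  = polF ^+ 4 * T (polF ^+ n) + polF * T (polF ^+ n.+1).
Proof.
rewrite !T_expF.
(* The scalars [G^4] and [G] are written as compositions with [G] so that [U_mulG] applies. *)
have -> : polF ^+ n.+4
    = ('X^4 \Po polG) * polF ^+ n + ('X \Po polG) * polF ^+ n.+1.
  rewrite comp_Xn_poly comp_polyX -addn4 exprD polFG_rel (exprS _ n); ring.
rewrite U_add !U_mulG comp_Xn_poly comp_polyX -(addn4 n) exprD polGF_rel
  !(exprS _ n).
ring.
Qed.

Lemma T_expF0 : T (polF ^+ 0) = 0.
Proof.
rewrite T_expF.
have := U_basis 1 0 0 0; rewrite !comp_polyC !mul0r !addr0 => ->.
apply: (poly_F2_eq 1); ring.
Qed.

Lemma T_expF1 : T (polF ^+ 1) = 0.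
Proof.
rewrite T_expF.
have := U_basis 'X 1 1 0.
rewrite !(comp_polyX, comp_polyC).
have -> : polG + 1 * 'X + 1 * 'X^2 + 0 * 'X^3 = polF ^+ 1.
  rewrite polFE; ring.
move=> ->; rewrite polFE; apply: (poly_F2_eq (polG + 'X + 'X^2)); ring.
Qed.

Lemma T_expF2 : T (polF ^+ 2) = 0.
Proof.
rewrite T_expF.
(* Coordinates of [F^2 = G^2 + r^2 + r^4], reduced by [r^4 = G + r^3]. *)
have := U_basis ('X^2 + 'X) 0 1 1.
rewrite !(comp_polyD, comp_Xn_poly, comp_polyX, comp_polyC).
have -> : polG ^+ 2 + polG + 0 * 'X + 1 * 'X^2 + 1 * 'X^3 = polF ^+ 2.
  rewrite polFE; apply: (poly_F2_eq (- (polG * ('X + 'X^2))));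
    rewrite /polG; ring.
move=> ->; rewrite polFE; apply: (poly_F2_eq (polG ^+ 2 + polG * ('X + 'X^2)
  + 'X^4 + 2 * 'X^3 + 2 * 'X^2 + 'X)); rewrite /polG; ring.
Qed.

Lemma T_expF3 : T (polF ^+ 3) = polF.
Proof.
rewrite T_expF.
(* Coordinates of [F^3], obtained by expanding [F^2 F] and reducing by [r^4 = G + r^3] and
   [r^5 = G r + G + r^3]. *)
have := U_basis ('X^3 + 'X^2 + 'X) 'X^2 'X^2 'X.
rewrite !(comp_polyD, comp_Xn_poly, comp_polyX, comp_polyC).
have -> : polG ^+ 3 + polG ^+ 2 + polG + polG ^+ 2 * 'X + polG ^+ 2 * 'X^2
    + polG * 'X^3 = polF ^+ 3.
  rewrite polFE; apply: (poly_F2_eq (- (polG * (polG + 'X^3 + 2 * 'X^2 + 'X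
    + polG * ('X + 'X^2))))); rewrite /polG; ring.
move=> ->; rewrite polFE; set s := 'X + 'X^2 : {poly 'F_2}.
apply: (poly_F2_eq (polG ^+ 3 + 2 * polG ^+ 2 * s + 2 * polG * s ^+ 2 + s ^+ 3
  + polG * s + s ^+ 2 + polG * (polG + 'X^3 + 'X^2 + 'X))).
rewrite /s /polG; ring.
Qed.

(** The recurrence gives [h_(n+4) = X^4 h_n + X h_(n+1)]. The first term raises exponent and index
    by 4; the second raises them by 1 and 3, which keeps the parity and leaves 2 to spare in the
    bound. Writing [k + 2 <= n] avoids truncated subtraction, so that [h = 0] is forced for
    [n < 2]. *)
Lemma T_expF_coef n : exists h : {poly 'F_2},
  T (polF ^+ n) = h \Po polF /\
  forall k, h`_k != 0 -> (k + 2 <= n)%N /\ k = n %[mod 2].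
Proof.
elim/ltn_ind: n => -[|[|[|[|n]]]] IHn.
- by exists 0; split=> [|k]; rewrite ?coef0 ?eqxx // comp_poly0 T_expF0.
- by exists 0; split=> [|k]; rewrite ?coef0 ?eqxx // comp_poly0 T_expF1.
- by exists 0; split=> [|k]; rewrite ?coef0 ?eqxx // comp_poly0 T_expF2.
- exists 'X; split=> [|k]; first by rewrite comp_polyX T_expF3.
  by rewrite coefX; case: (k =P 1) => [->|_]; rewrite ?eqxx.
have [h0 [T0 c0]] := IHn n (leq_addl 3 n.+1).
have [h1 [T1 c1]] := IHn n.+1 (leq_addl 2 n.+2).
exists ('X^4 * h0 + 'X * h1); split=> [|k].
  by rewrite T_expF_rec T0 T1
     !(comp_Xn_poly, comp_polyD, comp_polyM, comp_polyX).
rewrite coefD coefXnM coefXM => nz.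
(* A nonzero coefficient of the sum must come from at least one of the two summands. *)
have [nz0 | nz1] : (4 <= k)%N && (h0`_(k - 4) != 0)
    \/ (0 < k)%N && (h1`_k.-1 != 0).
  move: nz; case: ltnP => _; last first.
    by case: (h0`_(k - 4) =P 0) => [->|]; [rewrite add0r; case: k; auto | left].
  by rewrite add0r; case: k; auto.
- case/andP: nz0 => le4k /c0[le_n eq_n].
  rewrite -(subnK le4k) -(addn4 n) addnAC leq_add2r; split=> //.
  by rewrite -modnDml eq_n modnDml.
case/andP: nz1 => k_gt0 /c1[le_n eq_n].
rewrite -(prednK k_gt0) -(addn1 k.-1) addnAC; split.
  by rewrite addn1 ltnS (leq_trans le_n) // leqW // leqW.
by rewrite -modnDml eq_n modnDml addn1 -(modnDr n.+2 2) addn2.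
Qed.

Lemma F2_neq0 (c : 'F_2) : c != 0 -> c = 1.
Proof. by case: c => -[|[|]] // ? _; apply/val_inj. Qed.

Lemma T_comp h : T (h \Po polF) = \sum_(i < size h) h`_i *: T (polF ^+ i).
Proof.
have U0 : U 0 = 0 by have := U_mulG 0 0; rewrite !comp_poly0 !mul0r.
rewrite /T alpha_comp !comp_polyE (big_morph U U_add U0) -big_split /=.
apply: eq_bigr => i _; rewrite alpha_Fn scalerDr; congr (_ + _).
(* Scalars are constant polynomials, unchanged by composition, so semilinearity of [U] gives
   linearity over ['F_2]. *)
by have := U_mulG (h`_i)%:P (polF ^+ i); rewrite !comp_polyC !mul_polyC.
Qed.

Theorem theorem2p4 :
  [/\ T 1 = 0, T polF = 0, T (polF ^+ 2) = 0 & T (polF ^+ 3) = polF] /\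
  (forall f : {poly 'F_2}, in_Z2F f -> in_Z2F (T f)) /\
  (forall n : nat, exists s : seq nat,
     [/\ uniq s,
         forall k : nat, k \in s -> (k + 2 <= n)%N /\ k = n %[mod 2] &
         T (polF ^+ n) = \sum_(k <- s) polF ^+ k]).
Proof.
split.
  by split; [exact: T_expF0 | exact: T_expF1 | exact: T_expF2 | exact: T_expF3].
split=> [_ [h ->] | n].
  rewrite T_comp; apply: (big_ind in_Z2F).
  - by exists 0; rewrite comp_poly0.
  - by move=> _ _ [a ->] [b ->]; exists (a + b); rewrite comp_polyD.
  move=> i _; have [g [-> _]] := T_expF_coef i.
  by exists (h`_i *: g); rewrite comp_polyZ.
have [h [-> hP]] := T_expF_coef n.
(* A nonzero coefficient in ['F_2] equals 1, so [h(F)] is the sum of [F^k] over the support of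
   [h]. *)
exists [seq k <- iota 0 (size h) | h`_k != 0]; split.
- by rewrite filter_uniq ?iota_uniq.
- by move=> k; rewrite mem_filter => /andP[/hP].
rewrite comp_polyE big_filter -(big_mkord xpredT (fun i => h`_i *: polF ^+ i)).
rewrite /index_iota subn0 [RHS]big_mkcond; apply: eq_bigr => k _.
by case: eqP => [->|/eqP/F2_neq0->]; rewrite ?scale0r ?scale1r.
Qed.
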